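(* Fix $J,h\in\mathbb{R}$, a $G$-covariant transition rate $c$, $m\in\mathbb{N}$ and $p\in P_m$. For each $n\ge m$ let $\langle p\rangle_n^*$ be the minimum of $LP(p,n)$ and let $m_n^*$ be a minimizer, writing $\langle q\rangle_n^*=m_n^*(q)$ for $q\in P_n$. Then: (1) the limit $\langle p\rangle_\infty=\lim_{n\to\infty}\langle p\rangle_n^*$ exists; (2) for every $l\in\mathbb{N}$, the sequence of vectors $\big(\langle\underline{s}_A\rangle_n^*\big)_{A\subseteq D_l}\in\mathbb{R}^{2^{|D_l|}}$, $n\ge\max(m,l)$, has a convergent subsequence, indexed by some $Q\subseteq\{\max(m,l),\max(m,l)+1,\dots\}$, with limits $\langle\underline{s}_A\rangle_\infty=\lim_{n\in Q,n\to\infty}\langle\underline{s}_A\rangle_n^*$; (3) there exists a lattice-symmetric probability measure $\mu$ on $(S,V)$ which is invariant for the stochastic Ising model with rate $c$ and satisfies $\int p\,d\mu=\langle p\rangle_\infty$ and $\int\underline{s}_A\,d\mu=\langle\underline{s}_A\rangle_\infty$ for all $A\subseteq D_l$; (4) for every lattice-symmetric invariant probability measure $\mu'$ of the stochastic Ising model with rate $c$, $\int p\,d\mu\le\int p\,d\mu'$.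
   Context: $S=\{-1,1\}^{\mathbb{Z}^d}$ with $\sigma$-algebra $V$ generated by cylinder events $E(\{u_i\}_{i\in A})=\{s:s_i=u_i\ \forall i\in A\}$ ($A$ finite). $\underline{s}_A=\prod_{i\in A}s_i$ ($\underline{s}_\varnothing=1$); $P(S)$ is the real linear span of $\{\underline{s}_A:A\text{ finite}\}$; $D_n=\{i\in\mathbb{Z}^d:\|i\|_1\le n-1\}$ ($n\ge1$), $D_0=\varnothing$; $P_n$ is the span of $\{\underline{s}_A:A\subseteq D_n\}$ (functions of finitely many spins are reduced to such polynomials using $s_j^2=1$). $\bar s^i$ agrees with $s$ except $(\bar s^i)_i=-s_i$; $n(i)=\{j:\|i-j\|_1=1\}$; $F(\{u_i\}_{i\in A},s)=\prod_{i\in A}\frac{1+u_is_i}{2}$. Lattice symmetry group $G$: bijections of $\mathbb{Z}^d$ generated by unit translations, coordinate permutations and coordinate sign changes; $A\sim B$ iff $B=g(A)$ for some $g\in G$. A probability measure $\mu$ on $(S,V)$ is lattice-symmetric if $\int\underline{s}_A\,d\mu=\int\underline{s}_{g(A)}\,d\mu$ for all finite $A$ and $g\in G$. A transition rate at couplings $J,h$ is a family of strictly positive reals $c(i,s)$ such that $c(i,s)$ depends only on $s_i$ and $(s_j)_{j\in n(i)}$ and $c(i,s)\exp(hs_i+J\sum_{j\in n(i)}s_is_j)$ does not depend on $s_i$; it is $G$-covariant if $c(g(i),s\circ g^{-1})=c(i,s)$ for all $g\in G$. Example: $c^*(i,s)=C\big(1+\exp(-2hs_i-2J\sum_{j\in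 n(i)}s_is_j)\big)$, $C>0$ a constant. A probability measure $\mu$ on $(S,V)$ is invariant for the stochastic Ising model with rate $c$ if $\sum_{i\in\mathbb{Z}^d}\int c(i,s)(f(\bar s^i)-f(s))\,d\mu=0$ for all $f\in P(S)$ (only finitely many terms are nonzero; this is equivalent to the generator condition over the core of the Markov process). $LP(p,n)$ ($n\ge m$): minimize $m_n(p)$ over linear maps $m_n:P_n\to\mathbb{R}$ with (PB) $m_n(F(\{u_i\}_{i\in D_n},\cdot))\ge0$ for all $u\in\{-1,1\}^{D_n}$; (N) $m_n(1)=1$; (Sym) $m_n(\underline{s}_A)=m_n(\underline{s}_B)$ whenever $A,B\subseteq D_n$, $A\sim B$; (Inv) $\sum_{i\in D_{n-1}}m_n\big(c(i,s)(f(\bar s^i)-f(s))\big)=0$ for all $f\in P_{n-1}$. The feasible set is nonempty and compact, so the minimum is attained. *)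

(* Defs.v *)
From HB Require Import structures.
From mathcomp Require Import all_boot all_order all_algebra all_fingroup.
From mathcomp Require Import finmap.
From mathcomp Require Import all_classical all_reals all_analysis.

Set Implicit Arguments.
Unset Strict Implicit.
Unset Printing Implicit Defensive.

Import Order.TTheory GRing.Theory Num.Theory.
Local Open Scope ring_scope.

Definition site (d : nat) := 'rV[int]_d.

Definition norm1 d (i : site d) : nat := (\sum_(k < d) `|i ord0 k|%N)%N.

(** A box containing all sites with |i_k| <= n-1 (used only to enumerate D_n). *)
Definition box d (n : nat) : {fset site d} :=
  [fset x in map (fun f : {ffun 'I_d -> 'I_(2 * n)} =>
                   (\row_k ((f k : nat)%:Z - (n.-1)%:Z) : site d))
                (enum {: {ffun 'I_d -> 'I_(2 * n)}})]%fset.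

Definition D d (n : nat) : {fset site d} :=
  [fset i in box d n | (norm1 i < n)%N]%fset.

Definition unitvecs d : {fset site d} := [fset v in D d 2 | norm1 v == 1%N]%fset.
Definition nbr d (i : site d) : {fset site d} := [fset (i + v)%R | v in unitvecs d]%fset.

Inductive genG d : (site d -> site d) -> Prop :=
  | genG_transl (v : site d) : v \in unitvecs d -> genG (fun x => x + v)
  | genG_perm (sigma : {perm 'I_d}) : genG (fun x => \row_k x ord0 (sigma k))
  | genG_sign (k0 : 'I_d) :
      genG (fun x => \row_k (if k == k0 then - x ord0 k else x ord0 k)).

(** The group G generated by the generators (the generating set is closed
    under inverses, so the monoid generated is the group generated). *)
Inductive inG d : (site d -> site d) -> Prop :=
  | inG_id : inG id
  | inG_comp (g h : site d -> site d) : genG h -> inG g -> inG (h \o g).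

Definition lat_equiv d (A B : {fset site d}) : Prop :=
  exists g, inG g /\ B = [fset g x | x in A]%fset.

(** Spin configurations: true = +1, false = -1. *)
Definition S d := site d -> bool.

Section Spins.
Variables (R : realType) (d : nat).

Definition sp (s : S d) (i : site d) : R := if s i then 1 else -1.

Definition sA (A : {fset site d}) (s : S d) : R := \prod_(i <- A) sp s i.

Definition flip (i : site d) (s : S d) : S d :=
  fun j => if j == i then ~~ s j else s j.

Definition cfg (B : {fset site d}) : S d := fun j => j \notin B.

(** Coefficient of \underline{s}_A (A subset of L) in the multilinear
    (s_j^2 = 1 reduced) polynomial representing a function g of the spins in L. *)
Definition fourier (L : {fset site d}) (g : S d -> R) (A : {fset site d}) : R :=
  (2 ^- #|` L|) * \sum_(B <- fpowerset L) g (cfg B) * sA A (cfg B).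

(** A linear map m on span{ s_A : A subset of L } is encoded by its values
    mv A = m(s_A); lin_apply mv L g is m applied to (the reduced polynomial of) g. *)
Definition lin_apply (mv : {fset site d} -> R) (L : {fset site d}) (g : S d -> R) : R :=
  \sum_(A <- fpowerset L) fourier L g A * mv A.

Definition poly_eval (L : {fset site d}) (a : {fset site d} -> R) (s : S d) : R :=
  \sum_(A <- fpowerset L) a A * sA A s.

Definition Fcyl (L : {fset site d}) (u s : S d) : R :=
  \prod_(i <- L) ((1 + sp u i * sp s i) / 2).

Definition is_rate (J h : R) (c : site d -> S d -> R) : Prop :=
  [/\ forall i s, 0 < c i s,
      forall i s s', (forall j, j \in (i |` nbr i)%fset -> s j = s' j) -> c i s = c i s'
    & forall i s,
      c i s * expR (h * sp s i + J * \sum_(j <- nbr i) sp s i * sp s j)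
      = c i (flip i s) * expR (h * sp (flip i s) i
                         + J * \sum_(j <- nbr i) sp (flip i s) i * sp (flip i s) j)].

(** G-covariance: c(g(i), s o g^{-1}) = c(i, s), written with t = s o g^{-1}. *)
Definition covariant (c : site d -> S d -> R) : Prop :=
  forall g, inG g -> forall i (t : S d), c (g i) t = c i (t \o g).

Definition LP_feasible (c : site d -> S d -> R) (n : nat) (mv : {fset site d} -> R) : Prop :=
  [/\ forall u : S d, 0 <= lin_apply mv (D d n) (Fcyl (D d n) u),
      lin_apply mv (D d n) (fun _ => 1) = 1,
      forall A B, (A `<=` D d n)%fset -> (B `<=` D d n)%fset -> lat_equiv A B -> mv A = mv B
    & forall a : {fset site d} -> R,
      \sum_(i <- D d n.-1)
         lin_apply mv (D d n) (fun s => c i s * (poly_eval (D d n.-1) a (flip i s)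
                                           - poly_eval (D d n.-1) a s)) = 0].

End Spins.

Definition cyl d : set (set (S d)) :=
  [set E | exists (A : {fset site d}) (u : S d),
           E = [set s : S d | forall i, i \in A -> s i = u i]%classic]%classic.

Definition SM (d : nat) := g_sigma_algebraType (@cyl d).

Section Measures.
Variables (R : realType) (d : nat).
Local Open Scope ereal_scope.

Definition lattice_symmetric (mu : probability (SM d) R) : Prop :=
  forall (A : {fset site d}) g, inG g ->
    \int[mu]_s (sA R A s)%:E = \int[mu]_s (sA R [fset g x | x in A]%fset s)%:E.

(** Invariance: sum_i int c(i,s)(f(\bar s^i) - f(s)) dmu = 0 for all f in P(S);
    f = poly_eval L a, and only the terms i in L are nonzero. *)
Definition ising_invariant (c : site d -> S d -> R) (mu : probability (SM d) R) : Prop :=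
  forall (L : {fset site d}) (a : {fset site d} -> R),
    \sum_(i <- L) \int[mu]_s (c i s * (poly_eval L a (flip i s) - poly_eval L a s))%:E = 0.

End Measures.

(* Main.v *)
Require Import Defs.
From HB Require Import structures.
From mathcomp Require Import all_boot all_order all_algebra all_fingroup.
From mathcomp Require Import finmap.
From mathcomp Require Import all_classical all_reals all_analysis.
Import Order.TTheory GRing.Theory Num.Theory numFieldNormedType.Exports.
Local Open Scope classical_set_scope.
Local Open Scope ring_scope.

Set Implicit Arguments.
Unset Strict Implicit.
Unset Printing Implicit Defensive.

(** A moment functional that is nonnegative on cylinder functions and invariant on
    P_(n+1) restricts to one on P_n, so the optimal values increase with n; they are
    bounded because every moment lies in [-1, 1].  A diagonal extraction makes all
    moments of the minimizers converge along a subsequence.  The limit moments are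
    again nonnegative on cylinders, hence are the moments of a probability measure,
    obtained as the image of Lebesgue measure on the unit interval under the map
    reading off spins one at a time from successive subdivisions of the interval.
    Symmetry and invariance pass to the limit.  Conversely the moments of any
    symmetric invariant measure are feasible for every n, which gives minimality. *)

(** * Sums over the subsets of a finite set *)

Lemma big_fpowersetU1 (K : choiceType) (V : nmodType) (x : K) (L : {fset K})
    (H : {fset K} -> V) : x \notin L ->
  \sum_(B <- fpowerset (x |` L)%fset) H B =
  \sum_(B <- fpowerset L) (H B + H (x |` B)%fset).
Proof.
move=> xL; rewrite (big_fsetID _ (fun B : {fset K} => x \notin B)) big_split /=.
congr (_ + _).
  apply: eq_fbigl => B; rewrite !inE /= !fpowersetE.
  apply/andP/idP => [[BL xB]|BL]; last first.
    split; first exact: fsubset_trans BL (fsubsetU1 _ _).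
    by apply: contra xL; apply/fsubsetP.
  apply/fsubsetP => y yB; have /fset1UP[yx|//] := fsubsetP BL _ yB.
  by rewrite -yx yB in xB.
have <- : \sum_(C <- [fset (x |` B)%fset | B in fpowerset L]%fset) H C =
    \sum_(B <- fpowerset L) H (x |` B)%fset.
  rewrite big_imfset// => B C.
  rewrite /= !fpowersetE => BL CL /(congr1 (fun B => B `\ x)%fset).
  by rewrite !fsetU1K //; apply: contra xL; apply/fsubsetP.
apply: eq_fbigl => B; rewrite !inE /= !fpowersetE negbK.
apply/andP/imfsetP => [[BL xB]|[C /=]].
  exists (B `\ x)%fset; last by rewrite fsetD1K.
  by rewrite /= fpowersetE fsubDset.
rewrite fpowersetE => CL ->; split; first exact: fsetUS.
exact: fset1U1.
Qed.

(** Expanding the right-hand product picks one summand per index, and [B] records where [F] was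
    picked. This is what factors the sums below site by site. *)
Lemma sum_fpowerset_prod (K : choiceType) (R : comPzRingType) (L : {fset K})
    (F G : K -> R) :
  \sum_(B <- fpowerset L) \prod_(i <- L) (if i \in B then F i else G i) =
  \prod_(i <- L) (F i + G i).
Proof.
elim/fset1U_rect: L => [|x L xL IH].
  by rewrite fpowerset0 big_seq_fset1 !big_seq_fset0.
rewrite big_fpowersetU1// big_fsetU1//= -IH mulr_sumr big_seq [RHS]big_seq.
apply: eq_bigr => B; rewrite fpowersetE => BL.
have xB : x \notin B by apply: contra xL; apply/fsubsetP.
rewrite !big_fsetU1//= (negbTE xB) fset1U1 [RHS]mulrDl addrC; congr (_ * _ + _).
apply: eq_big_seq => i iL; rewrite in_fset1U.
by case: eqP => // ix; rewrite -ix iL in xL.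
Qed.

Lemma prod_fset_const (K : choiceType) (R : pzRingType) (L : {fset K}) (r : R) :
  \prod_(i <- L) r = r ^+ #|` L|.
Proof. by rewrite big_const_seq count_predT iter_mulr_1. Qed.

(** * Local functions and their Fourier expansion *)

Definition local (R : realType) d (L : {fset site d}) (g : S d -> R) :=
  forall s s' : S d, (forall j, j \in L -> s j = s' j) -> g s = g s'.

Section Fourier.
Context {R : realType} {d : nat}.
Implicit Types (L A B : {fset site d}) (g : S d -> R) (s u : S d)
  (mv a : {fset site d} -> R).

Lemma sp_sqr s i : sp R s i * sp R s i = 1.
Proof. by rewrite /sp; case: (s i); rewrite ?mulr1// mulrNN mulr1. Qed.

Lemma sp_mul_eq s u i : s i = u i -> sp R s i * sp R u i = 1.
Proof. by move=> su; rewrite -(sp_sqr u i) /sp su. Qed.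

Lemma sp_mul_neq s u i : s i != u i -> sp R s i * sp R u i = -1.
Proof. by rewrite /sp; case: (s i); case: (u i); rewrite ?mulr1 ?mul1r. Qed.

Lemma sp_cfg B i : sp R (cfg B) i = if i \in B then -1 else 1.
Proof. by rewrite /sp /cfg; case: (i \in B). Qed.

Lemma sA_widen L A s : (A `<=` L)%fset ->
  sA R A s = \prod_(i <- L) (if i \in A then sp R s i else 1).
Proof.
move=> AL; rewrite -(big_fset_incl _ AL) => [|x _ /negbTE->//].
by apply: eq_big_seq => i ->.
Qed.

Lemma local_widen L L' g : (L `<=` L')%fset -> local L g -> local L' g.
Proof. by move=> /fsubsetP LL' lg s s' ss'; apply: lg => j /LL' /ss'. Qed.

Lemma local_cst L (r : R) : local L (fun=> r).
Proof. by []. Qed.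

Lemma local_sA A L : (A `<=` L)%fset -> local L (@sA R d A).
Proof.
move=> /fsubsetP AL s s' ss'; apply: eq_big_seq => i /AL iL.
by rewrite /sp ss'.
Qed.

Lemma local_poly L a : local L (poly_eval L a).
Proof.
move=> s s' ss'; apply: eq_big_seq => A; rewrite fpowersetE => AL.
by congr (_ * _); exact: (local_sA AL).
Qed.

Lemma local_Fcyl L u : local L (@Fcyl R d L u).
Proof. by move=> s s' ss'; apply: eq_big_seq => i iL; rewrite /sp ss'. Qed.

Lemma Fcyl1 L u s : (forall i, i \in L -> s i = u i) -> Fcyl R L u s = 1.
Proof.
move=> su; rewrite /Fcyl big_seq big1// => i iL.
by rewrite sp_mul_eq ?su// -[X in X / _]/(2%:R) divff// pnatr_eq0.
Qed.

Lemma Fcyl0 L u s i : i \in L -> s i != u i -> Fcyl R L u s = 0.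
Proof.
move=> iL su; rewrite /Fcyl (big_fsetD1 i)//=.
by rewrite sp_mul_neq 1?eq_sym// subrr mul0r mul0r.
Qed.

Lemma cfgE L s i : i \in L -> cfg [fset j in L | ~~ s j]%fset i = s i.
Proof. by move=> iL; rewrite /cfg !inE iL negbK. Qed.

(** Only the cylinder of the configuration agreeing with [s] on [L] survives; it is indexed by [Bs],
    the set of minus sites of [s] in [L]. *)
Lemma local_cylE L g s : local L g ->
  g s = \sum_(B <- fpowerset L) g (cfg B) * Fcyl R L (cfg B) s.
Proof.
move=> lg; set Bs := [fset j in L | ~~ s j]%fset.
have BsL : (Bs `<=` L)%fset by apply/fsubsetP => j; rewrite !inE => /andP[].
rewrite (big_fsetD1 Bs) ?fpowersetE//= Fcyl1 => [|i iL]; last by rewrite cfgE.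
rewrite mulr1 big_seq big1 ?addr0 => [|B].
  by apply: lg => j jL; rewrite cfgE.
rewrite in_fsetD1 fpowersetE => /andP[BBs BL].
have [i iL iB] : exists2 i, i \in L & s i != cfg B i.
  apply: contrapT => nex; case/negP: BBs; apply/eqP/fsetP => j.
  rewrite !inE; have [jL|jL] /= := boolP (j \in L).
    have: ~~ (s j != cfg B j) by apply/negP => jB; apply: nex; exists j.
    by rewrite negbK => /eqP ->; rewrite /cfg negbK.
  by apply: contraNF jL; apply: (fsubsetP BL).
by rewrite (Fcyl0 iL iB) mulr0.
Qed.

(** Completeness of the monomials: expand the product of the factors [1 + sp R s i * sp R u i]. *)
Lemma sum_sA L s u : \sum_(A <- fpowerset L) sA R A s * sA R A u =
  2 ^+ #|` L| * Fcyl R L u s.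
Proof.
transitivity (\prod_(i <- L) (sp R s i * sp R u i + 1)).
  rewrite -sum_fpowerset_prod; apply: eq_big_seq => A; rewrite fpowersetE => AL.
  rewrite !(sA_widen _ AL) -big_split/=; apply: eq_bigr => i _.
  by case: ifP => //; rewrite mulr1.
rewrite /Fcyl -prod_fset_const -big_split/=.
by apply: eq_bigr => i _; rewrite [RHS]mulrC divfK ?pnatr_eq0// addrC mulrC.
Qed.

Lemma fourier_inversion L g s : local L g ->
  g s = \sum_(A <- fpowerset L) fourier L g A * sA R A s.
Proof.
move=> lg; rewrite (local_cylE s lg) /fourier.
under [RHS]eq_bigr do rewrite -mulrA mulr_suml mulr_sumr.
rewrite exchange_big/=; apply: eq_bigr => B _.
transitivity (2 ^- #|` L| * (g (cfg B) *
    \sum_(A <- fpowerset L) sA R A s * sA R A (cfg B))).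
  rewrite sum_sA [RHS]mulrCA; congr (_ * _).
  by rewrite mulrA mulVf ?mul1r// expf_neq0// pnatr_eq0.
rewrite !mulr_sumr; apply: eq_bigr => A _.
by rewrite -mulrA [sA _ _ s * _]mulrC.
Qed.

(** Orthogonality of the monomials: the sum over configurations factors over sites, and a site
    contributes 2 if it lies in both or neither of [A], [A'], and 0 otherwise. *)
Lemma fourier_sA L A A' : (A `<=` L)%fset -> (A' `<=` L)%fset ->
  fourier L (@sA R d A) A' = (A == A')%:R.
Proof.
move=> AL A'L; rewrite /fourier.
transitivity (2 ^- #|` L| *
    \prod_(i <- L) (((-1) ^+ (i \in A) * (-1) ^+ (i \in A') + 1) : R)).
  congr (_ * _); rewrite -sum_fpowerset_prod; apply: eq_big_seq => B BL.
  rewrite (sA_widen _ AL) (sA_widen _ A'L) -big_split/=.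
  apply: eq_bigr => i _; rewrite sp_cfg.
  by case: (i \in B); case: (i \in A); case: (i \in A'); rewrite ?mulr1 ?expr0 ?expr1.
have [->|AA'] := eqVneq A A'.
  rewrite (eq_bigr (fun=> 2)) ?prod_fset_const ?mulVf ?expf_neq0 ?pnatr_eq0//.
  by move=> i _; rewrite -signr_addb addbb expr0.
have [i iL iAA'] : exists2 i, i \in L & (i \in A) != (i \in A').
  apply: contrapT => nex; case/eqP: AA'; apply/fsetP => j.
  have [jL|jL] := boolP (j \in L).
    by apply: contrapT => jAA'; apply: nex; exists j => //; exact/eqP.
  by rewrite (contraNF (fsubsetP AL j) jL) (contraNF (fsubsetP A'L j) jL).
rewrite (big_fsetD1 i)//= -signr_addb -negb_eqb iAA' expr1 addNr.
by rewrite mul0r mulr0.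
Qed.

Lemma lin_applyD mv L g g' :
  lin_apply mv L (fun s => g s + g' s) = lin_apply mv L g + lin_apply mv L g'.
Proof.
rewrite /lin_apply -big_split/=; apply: eq_bigr => A _.
rewrite -mulrDl; congr (_ * _); rewrite /fourier -mulrDr -big_split/=.
by congr (_ * _); apply: eq_bigr => B _; rewrite mulrDl.
Qed.

Lemma lin_applyZ mv L r g :
  lin_apply mv L (fun s => r * g s) = r * lin_apply mv L g.
Proof.
rewrite /lin_apply mulr_sumr; apply: eq_bigr => A _.
rewrite mulrA; congr (_ * _); rewrite /fourier [RHS]mulrCA; congr (_ * _).
by rewrite mulr_sumr; apply: eq_bigr => B _; rewrite mulrA.
Qed.

Lemma lin_apply_sum mv L (I : Type) (r : seq I) (P : pred I) (F : I -> S d -> R) :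
  lin_apply mv L (fun s => \sum_(i <- r | P i) F i s) =
  \sum_(i <- r | P i) lin_apply mv L (F i).
Proof.
elim: r => [|i r IH].
  transitivity (lin_apply mv L (fun s => 0 * 0)); last first.
    by rewrite lin_applyZ mul0r big_nil.
  by congr lin_apply; apply/funext => s; rewrite big_nil mul0r.
rewrite big_cons -IH; case: ifP => Pi; last first.
  by congr lin_apply; apply/funext => s; rewrite big_cons Pi.
by rewrite -lin_applyD; congr lin_apply; apply/funext => s; rewrite big_cons Pi.
Qed.

Lemma lin_apply0 mv L : lin_apply mv L (fun=> 0) = 0.
Proof.
rewrite -[RHS](mul0r (lin_apply mv L (fun=> 0))) -lin_applyZ.
by congr lin_apply; apply/funext => s; rewrite mul0r.
Qed.

Lemma lin_apply_sA mv L A : (A `<=` L)%fset -> lin_apply mv L (@sA R d A) = mv A.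
Proof.
move=> AL; rewrite /lin_apply (big_fsetD1 A) ?fpowersetE//= fourier_sA// eqxx mul1r.
rewrite big_seq big1 ?addr0// => A'.
rewrite in_fsetD1 fpowersetE => /andP[AA' A'L].
by rewrite fourier_sA// eq_sym (negbTE AA') mul0r.
Qed.

(** Makes the value of a functional independent of the chosen box: once [g] is expanded over the
    subsets of [L], both sides send each monomial to its moment. *)
Lemma lin_apply_widen mv L L' g : (L `<=` L')%fset -> local L g ->
  lin_apply mv L' g = lin_apply mv L g.
Proof.
move=> LL' lg; have -> : g = fun s => \sum_(A <- fpowerset L) fourier L g A * sA R A s.
  by apply/funext => s; exact: fourier_inversion.
rewrite !lin_apply_sum; apply: eq_big_seq => A; rewrite fpowersetE => AL.
by rewrite !lin_applyZ !lin_apply_sA// (fsubset_trans AL).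
Qed.

Lemma lin_apply_poly mv L a :
  lin_apply mv L (poly_eval L a) = \sum_(A <- fpowerset L) a A * mv A.
Proof.
rewrite /poly_eval lin_apply_sum; apply: eq_big_seq => A; rewrite fpowersetE => AL.
by rewrite lin_applyZ lin_apply_sA.
Qed.

Lemma lin_apply_cst mv L r : lin_apply mv L (fun=> r) = r * mv fset0.
Proof.
rewrite -(lin_apply_sA mv (fsub0set L)) -lin_applyZ; congr lin_apply.
by apply/funext => s; rewrite /sA big_seq_fset0 mulr1.
Qed.

Lemma lin_apply_cylE mv L g : local L g ->
  lin_apply mv L g =
  \sum_(B <- fpowerset L) g (cfg B) * lin_apply mv L (Fcyl R L (cfg B)).
Proof.
move=> lg; rewrite -[in LHS](_ : (fun s =>
    \sum_(B <- fpowerset L) g (cfg B) * Fcyl R L (cfg B) s) = g); last first.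
  by apply/funext => s; rewrite -local_cylE.
by rewrite lin_apply_sum; apply: eq_bigr => B _; rewrite lin_applyZ.
Qed.

Lemma lin_apply_ge0 mv L g : (forall u, 0 <= lin_apply mv L (Fcyl R L u)) ->
  local L g -> (forall s, 0 <= g s) -> 0 <= lin_apply mv L g.
Proof.
move=> pos lg g0; rewrite lin_apply_cylE//.
by apply: sumr_ge0 => B _; apply: mulr_ge0.
Qed.

Lemma sA_bound A s : -1 <= sA R A s <= 1.
Proof.
rewrite -ler_norml /sA normr_prod big1// => i _.
by rewrite /sp; case: (s i); rewrite ?normrN normr1.
Qed.

(** Positivity is applied to the nonnegative local functions [1 + sA R A s] and [1 - sA R A s]. *)
Lemma moment_bound mv L A : (A `<=` L)%fset ->
  (forall u, 0 <= lin_apply mv L (Fcyl R L u)) ->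
  lin_apply mv L (fun=> 1) = 1 -> `|mv A| <= 1.
Proof.
move=> AL pos one; rewrite ler_norml -(lin_apply_sA mv AL); apply/andP; split.
  rewrite -subr_ge0 opprK -[X in _ + X]one -lin_applyD; apply: lin_apply_ge0 => //.
    by move=> s s' ss'; congr (_ + _); apply: (local_sA AL).
  by move=> s; rewrite -[1]opprK subr_ge0; case/andP: (sA_bound A s).
rewrite -subr_ge0 -[X in X - _]one -mulN1r -lin_applyZ -lin_applyD.
apply: lin_apply_ge0 => //.
  by move=> s s' ss'; rewrite (local_sA AL ss').
by move=> s; rewrite mulN1r subr_ge0; case/andP: (sA_bound A s).
Qed.

End Fourier.

(** * Integration of local functions *)

Definition cylset d (L : {fset site d}) (u : S d) : set (SM d) :=
  [set s : S d | forall i, i \in L -> s i = u i].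

Lemma measurable_cylset d (L : {fset site d}) (u : S d) :
  measurable (cylset L u).
Proof. by apply: sub_sigma_algebra; exists L, u. Qed.

Lemma Fcyl_indic (R : realType) d (L : {fset site d}) (u : S d) :
  Fcyl R L u = \1_(cylset L u).
Proof.
apply/funext => s; rewrite indicE.
have [su|] := pselect (cylset L u s); first by rewrite Fcyl1// mem_set.
move=> nsu; rewrite memNset//.
have [i iL siu] : exists2 i, i \in L & s i != u i.
  apply: contrapT => nex; apply: nsu => i iL; apply: contrapT => siu.
  by apply: nex; exists i => //; exact/eqP.
exact: Fcyl0 iL siu.
Qed.

(** The cylinder expansion exhibits [g] as a simple function, so integrability reduces to that of
    finitely many indicators. *)
Lemma integral_local (R : realType) d (mu : probability (SM d) R)
    (L : {fset site d}) (g : S d -> R) : local L g ->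
  (\int[mu]_s (g s)%:E =
   (\sum_(B <- fpowerset L) g (cfg B) * fine (mu (cylset L (cfg B))))%R%:E)%E.
Proof.
move=> lg; pose f B (s : SM d) := ((g (cfg B))%:E * (\1_(cylset L (cfg B)) s)%:E)%E.
have intI B : mu.-integrable setT (fun s => (\1_(cylset L (cfg B)) s : R)%:E).
  by apply: integrable_indic; exact: measurable_cylset.
transitivity (\int[mu]_s \sum_(B <- fpowerset L) f B s)%E.
  apply: eq_integral => s _; rewrite (local_cylE s lg) -sumEFin.
  by apply: eq_bigr => B _; rewrite EFinM Fcyl_indic.
rewrite integral_sum//; last by move=> B; exact: integrableZl.
rewrite -sumEFin; apply: eq_bigr => B _.
rewrite integralZl// integral_indic//; last exact: measurable_cylset.
by rewrite setIT EFinM fineK// fin_num_measure//; exact: measurable_cylset.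
Qed.

(** * Measures with prescribed moments *)

Section BinarySplitting.
Context {R : realType}.
Variable p : seq bool -> R.
Hypothesis p_ge0 : forall w, 0 <= p w.
Hypothesis p_nil : p [::] = 1.
Hypothesis p_cons : forall w, p (false :: w) + p (true :: w) = p w.

(* Words list the most recent binary digit first. The unit interval is cut into
   intervals of length [p w], one for each word [w] of a given size; [left_end w]
   is the left end of the interval of [w] and [digits t n] is the word of size
   [n] whose interval contains [t]. *)
Fixpoint left_end (w : seq bool) : R :=
  if w is b :: w' then left_end w' + (if b then p (false :: w') else 0) else 0.

Fixpoint digits (t : R) (n : nat) : seq bool :=
  if n is n'.+1 then
    (left_end (digits t n') + p (false :: digits t n') <= t) :: digits t n'
  else [::].

Definition digit (t : R) (n : nat) : bool := head false (digits t n.+1).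

Lemma digitsE t n : digits t n = rev (mkseq (digit t) n).
Proof. by elim: n => // n IH; rewrite mkseqS rev_rcons -IH. Qed.

(** By [p_cons], the interval of [w] is cut at [left_end w + p (false :: w)] into the half-open
    intervals of its two extensions; the new digit tells on which side of the cut [t] lies. *)
Lemma digits_itv t w :
  (0 <= t < 1) && (digits t (size w) == w) = (left_end w <= t < left_end w + p w).
Proof.
elim: w => [|b w IH] /=; first by rewrite eqxx andbT p_nil add0r.
rewrite eqseq_cons [X in _ && X]andbC andbA.
(* The cut used by [digits] depends on [t], but where the digits spell [w] it is the cut of [w];
   elsewhere both sides are false. *)
have -> : (0 <= t < 1) && (digits t (size w) == w) &&
    ((left_end (digits t (size w)) + p (false :: digits t (size w)) <= t) == b) =
    (0 <= t < 1) && (digits t (size w) == w) &&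
    ((left_end w + p (false :: w) <= t) == b).
  by case: (digits t (size w) =P w) => [->//|_]; rewrite !andbF.
rewrite IH; have := p_cons w; have := p_ge0 (false :: w); have := p_ge0 (true :: w).
case: b => pt0 pf0 pw.
  rewrite eqb_id -addrA pw; case: (leP (_ + p (false :: w)) t) => ht; last first.
    by rewrite !andbF.
  by rewrite andbT (le_trans _ ht)// lerDl.
rewrite eqbF_neg -ltNge addr0; case: (ltP t (_ + p (false :: w))) => ht.
  rewrite !andbT (lt_le_trans ht) ?andbT// lerD2l.
  by rewrite -pw lerDl.
by rewrite !andbF.
Qed.

Lemma measurable_digits n w :
  measurable ([set t | digits t n = w] : set (measurableTypeR R)).
Proof.
elim: n w => [|n IH] [|b w] /=.
- by rewrite (_ : [set _ | _] = setT)//; apply/seteqP; split.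
- by rewrite (_ : [set _ | _] = set0)//; apply/seteqP; split.
- by rewrite (_ : [set _ | _] = set0)//; apply/seteqP; split.
rewrite (_ : [set _ | _] = [set t | digits t n = w] `&`
    (if b then `[left_end w + p (false :: w), +oo[%classic
     else `]-oo, left_end w + p (false :: w)[%classic)).
  by apply: measurableI; [exact: IH|case: b; exact: measurable_itv].
apply/seteqP; split => t /=.
  move=> [<- <-]; split=> //.
  by case: leP => ht; rewrite /= in_itv/= ?ht ?andbT.
move=> [->]; case: b; rewrite /= in_itv/= ?andbT => ht; congr cons => //.
by apply/negbTE; rewrite -ltNge.
Qed.

Lemma lebesgue_digits w :
  lebesgue_measure ([set t | digits t (size w) = w] `&` `[0, 1[%classic) = (p w)%:E.
Proof.
rewrite (_ : _ `&` _ = `[left_end w, left_end w + p w[%classic).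
  rewrite lebesgue_measure_itv/= lte_fin ltrDl lt_neqAle p_ge0 andbT.
  have [<-//|_] /= := eqVneq 0 (p w).
  by rewrite -EFinD addrAC subrr add0r.
apply/seteqP; split => t /=; rewrite !in_itv/= -digits_itv.
  by move=> [/eqP-> ->].
by move=> /andP[-> /eqP].
Qed.

Definition words (K : nat) (Q : pred (seq bool)) : {fset seq bool} :=
  [fset w in [seq tval w | w <- enum {: K.-tuple bool}] | Q w]%fset.

Lemma in_words K Q w : (w \in words K Q) = (size w == K) && Q w.
Proof.
rewrite !inE /=; congr (_ && _); apply/mapP/eqP => [[v _ ->]|sw].
  exact: size_tuple.
by exists (tcast sw (in_tuple w)); rewrite ?mem_enum// val_tcast.
Qed.

Lemma digits_bigcup K (Q : pred (seq bool)) : [set t | Q (digits t K)] =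
  \big[setU/set0]_(w <- words K Q) [set t | digits t K = w].
Proof.
rewrite -bigcup_fset; apply/seteqP; split => t /=.
  move=> Qt; exists (digits t K) => //=; rewrite in_words Qt andbT.
  by rewrite digitsE size_rev size_mkseq.
by move=> [w /=]; rewrite in_words => /andP[_ Qw] ->.
Qed.

Lemma measurable_digits_pred K (Q : pred (seq bool)) :
  measurable ([set t | Q (digits t K)] : set (measurableTypeR R)).
Proof.
by rewrite digits_bigcup; apply: bigsetU_measurable => w _; exact: measurable_digits.
Qed.

Lemma lebesgue_digits_pred K (Q : pred (seq bool)) :
  lebesgue_measure ([set t | Q (digits t K)] `&` `[0, 1[%classic) =
  (\sum_(w <- words K Q) p w)%:E.
Proof.
rewrite digits_bigcup big_distrl/=.
rewrite (@measure_fbigsetU _ _ (measurableTypeR R) lebesgue_measure)//=.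
- rewrite -sumEFin; apply: eq_big_seq => w; rewrite in_words => /andP[/eqP<- _].
  exact: lebesgue_digits.
- by move=> w _; apply: measurableI; [exact: measurable_digits|exact: measurable_itv].
- by apply/trivIsetP => v w _ _ /eqP vw; apply/seteqP; split => t //= [[-> _] [/vw]].
Qed.

End BinarySplitting.

(** Normalization supplies the probability structure and, at total mass 1, changes no value. *)
Lemma probability_of_measure (disp : measure_display) (T : measurableType disp)
    (R : realType) (nu : {measure set T -> \bar R}) :
  nu setT = 1%E -> exists P : probability T R, P = nu :> (set T -> \bar R).
Proof.
move=> nu1; exists (mnormalize nu point); apply/funext => A.
by rewrite /= /mnormalize nu1 onee_eq0/= invr1 mule1.
Qed.

Section MomentProblem.
Context {R : realType} {d : nat}.
Variable mv : {fset site d} -> R.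
Hypothesis mv_pos : forall L u, 0 <= lin_apply mv L (Fcyl R L u).
Hypothesis mv_one : mv fset0 = 1.

(* Repetitions in this enumeration are harmless: words that are inconsistent on a
   repeated site get probability 0. *)
Let enum_site (n : nat) : site d := odflt 0 (choice.unpickle n).

Let rank : site d -> nat := choice.pickle.

Let rankK : cancel rank enum_site.
Proof. by move=> x; rewrite /enum_site choice.pickleK. Qed.

Let prefix (s : S d) (n : nat) : seq bool := rev (mkseq (s \o enum_site) n).

Let sites (n : nat) : {fset site d} := [fset enum_site i | i in iota 0 n]%fset.

(** The mass that the moments assign to the event that the first enumerated spins, latest first,
    spell [w]; it provides the interval lengths for the binary splitting. *)
Let word_prob (w : seq bool) : R :=
  lin_apply mv (sites (size w)) (fun s => (prefix s (size w) == w)%:R).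

Let prefixS s n : prefix s n.+1 = s (enum_site n) :: prefix s n.
Proof. by rewrite /prefix mkseqS rev_rcons. Qed.

Let local_prefix n (f : seq bool -> R) : local (sites n) (fun s => f (prefix s n)).
Proof.
move=> s s' ss'; congr (f (rev _)); apply/eq_in_map => i i_n /=.
by apply: ss'; apply/imfsetP; exists i.
Qed.

Let word_prob_ge0 w : 0 <= word_prob w.
Proof.
apply: lin_apply_ge0 => [u||s]; [exact: mv_pos| |exact: ler0n].
exact: (local_prefix (fun v => (v == w)%:R)).
Qed.

Let word_prob_nil : word_prob [::] = 1.
Proof. by rewrite /word_prob /= lin_apply_cst mul1r. Qed.

(** A configuration with prefix [w] matches exactly one of the two extensions; widening first puts
    all three terms on the same box. *)
Let word_prob_cons w : word_prob (false :: w) + word_prob (true :: w) = word_prob w.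
Proof.
rewrite /word_prob -lin_applyD /=.
rewrite -(lin_apply_widen mv (L' := sites (size w).+1)); last 2 first.
- apply/fsubsetP => x /imfsetP[i /= i_n ->]; apply/imfsetP; exists i => //=.
  by move: i_n; rewrite -[0%N :: _]/(iota 0 (size w).+1) !mem_iota; exact: leqW.
- exact: (local_prefix (fun v => (v == w)%:R)).
congr lin_apply; apply/funext => s; rewrite prefixS !eqseq_cons -natrD.
by case: (s _); rewrite ?add0n ?addn0.
Qed.

(** Ranks start at 0, hence the successor: words of this length reach every site of [L]. *)
Let bound (L : {fset site d}) : nat := (\max_(x <- L) rank x).+1.

Let bound_gt L x : x \in L -> (rank x < bound L)%N.
Proof. by move=> xL; rewrite ltnS; exact: leq_bigmax_seq. Qed.

(** Here [rev] undoes the latest-first order, so that index [rank x] holds the spin at [x]. *)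
Let agrees (L : {fset site d}) (u : S d) (w : seq bool) : bool :=
  all (fun x => nth false (rev w) (rank x) == u x) L.

Let agreesP L u (b : nat -> bool) :
  reflect (forall x, x \in L -> b (rank x) = u x)
    (agrees L u (rev (mkseq b (bound L)))).
Proof.
apply: (iffP allP) => bu x xL.
  by have := bu x xL; rewrite revK nth_mkseq ?bound_gt// => /eqP.
by rewrite revK nth_mkseq ?bound_gt//; apply/eqP/bu.
Qed.

Let config (t : measurableTypeR R) : SM d := fun x => digit word_prob t (rank x).

Let config_cylset L u : config @^-1` (cylset L u) =
  [set t | agrees L u (digits word_prob t (bound L))].
Proof.
apply/seteqP; split => t; rewrite /preimage /mkset digitsE => tu.
  exact/agreesP.
exact: (agreesP _ _ _ tu).
Qed.

Let measurable_config : measurable_fun setT config.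
Proof.
apply: (@measurability _ _ (measurableTypeR R) (SM d) setT config (@cyl d) erefl).
move=> _ [_ [L [u ->]] <-]; rewrite setTI -/(cylset L u) config_cylset.
exact: measurable_digits_pred.
Qed.

Let unit_measurable : measurable (`[0, 1[%classic : set (measurableTypeR R)).
Proof. exact: measurable_itv. Qed.

(** The mass is the sum of [word_prob] over the words agreeing with [u] on [L]. By linearity it is
    the functional of a sum of prefix indicators, which is the cylinder function because each
    configuration has a single prefix. *)
Let lebesgue_config_cylset L u :
  mrestr lebesgue_measure unit_measurable (config @^-1` cylset L u) =
  (lin_apply mv L (Fcyl R L u))%:E.
Proof.
rewrite /mrestr config_cylset lebesgue_digits_pred//; congr EFin.
set K := bound L; have LK : (L `<=` sites K)%fset.
  apply/fsubsetP => x xL; apply/imfsetP; exists (rank x); last by rewrite rankK.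
  by rewrite -[_ \in _]/(rank x \in iota 0 K) mem_iota add0n bound_gt.
rewrite -(lin_apply_widen mv LK (@local_Fcyl R d L u)).
transitivity (lin_apply mv (sites K)
    (fun s => \sum_(w <- words K (agrees L u)) (prefix s K == w)%:R)).
  rewrite lin_apply_sum; apply: eq_big_seq => w; rewrite in_words => /andP[/eqP wK _].
  by rewrite /word_prob wK.
congr lin_apply; apply/funext => s.
have sK : size (prefix s K) = K by rewrite size_rev size_mkseq.
have sum0 (Q : pred (seq bool)) : ~~ Q (prefix s K) ->
    \sum_(w <- words K Q) (prefix s K == w)%:R = 0 :> R.
  move=> nQ; rewrite big_seq big1// => w; rewrite in_words => /andP[_ Qw].
  by case: eqP => // sw; rewrite sw Qw in nQ.
have [As|nAs] := boolP (agrees L u (prefix s K)).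
  rewrite (big_fsetD1 (prefix s K)) ?in_words ?sK ?eqxx//= big_seq big1 ?addr0.
    rewrite Fcyl1// => x xL.
    have /(_ x xL) := agreesP _ _ _ As.
    by rewrite /= rankK.
  by move=> w; rewrite in_fsetD1 eq_sym => /andP[/negbTE->].
rewrite sum0//; apply/esym; rewrite Fcyl_indic indicE memNset// => su.
case/negP: nAs; apply/agreesP => x xL /=.
by rewrite rankK su.
Qed.

Lemma moment_problem : exists mu : probability (SM d) R,
  forall L (g : S d -> R), local L g ->
    (\int[mu]_s (g s)%:E = (lin_apply mv L g)%:E)%E.
Proof.
have [P PE] : exists P : probability (measurableTypeR R) R,
    P = mrestr lebesgue_measure unit_measurable :> (set _ -> \bar R).
  apply: probability_of_measure; rewrite /= /mrestr setTI lebesgue_measure_itv/=.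
  by rewrite lte_fin ltr01 -EFinB subr0.
pose X : {mfun measurableTypeR R >-> SM d} := mfun_Sub (mem_set measurable_config).
exists (distribution P X) => L g lg; rewrite (integral_local _ lg) (lin_apply_cylE _ lg).
congr EFin; apply: eq_bigr => B _; congr (_ * _).
by rewrite /= /distribution /pushforward PE lebesgue_config_cylset.
Qed.

End MomentProblem.

Definition moments (R : realType) d (mu : probability (SM d) R) (A : {fset site d}) : R :=
  fine (\int[mu]_s (sA R A s)%:E)%E.

(** Both sides are written in cylinder masses; Fourier inversion at [cfg B] matches the
    coefficients. *)
Lemma lin_apply_moments (R : realType) d (mu : probability (SM d) R)
    (L : {fset site d}) (g : S d -> R) : local L g ->
  (\int[mu]_s (g s)%:E = (lin_apply (moments mu) L g)%:E)%E.
Proof.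
move=> lg; rewrite (integral_local mu lg); congr EFin; rewrite /lin_apply.
under [RHS]eq_big_seq => A; first rewrite fpowersetE => AL.
  rewrite /moments (integral_local mu (local_sA AL)) /= mulr_sumr; over.
rewrite exchange_big/=; apply: eq_bigr => B _.
rewrite [in LHS](fourier_inversion (cfg B) lg) mulr_suml.
by apply: eq_bigr => A _; rewrite mulrA.
Qed.

(** * Diagonal extraction *)

Lemma ultra_fmap (T U : Type) (f : T -> U) (F : set_system T) :
  UltraFilter F -> UltraFilter (f @ F).
Proof.
move=> FU; split=> [|G GF fFG]; first exact: fmap_proper_filter.
apply/seteqP; split => A; last exact: fFG.
move=> GA; have [//|FnA] := in_ultra_setVsetC (f @^-1` A) FU.
have GnA : G (~` A) by apply: fFG.
have /filter_ex[x []//] : G (A `&` ~` A) by apply: filterI.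
Qed.

(** Limits along one ultrafilter finer than [\oo] exist for all [A] at once and do not depend on
    [N]. Since [E k] is finite, some late index is within [k.+1%:R^-1] of all limits indexed by
    [E k]. *)
Lemma pointwise_subsequence (R : realType) (T : choiceType) (E : nat -> {fset T})
    (x : nat -> T -> R) : (forall A, \forall n \near \oo, `|x n A| <= 1) ->
  exists lim : T -> R, forall N, exists phi : nat -> nat,
    [/\ forall k, (N <= phi k)%N, forall k, (phi k < phi k.+1)%N &
        forall A, (\forall k \near \oo, A \in E k) ->
          x (phi k) A @[k --> \oo] --> lim A].
Proof.
move=> x1; have [U [UU ooU]] := @ultraFilterLemma _ (nbhs \oo) _.
have lim_ex A : exists l : R, x n A @[n --> U] --> l.
  have := @segment_compact R (-1) 1; rewrite compact_ultra.
  move=> /(_ _ (ultra_fmap (fun n => x n A) UU)) [|l [_ xl]]; last by exists l.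
  apply: ooU; move: (x1 A); apply: filterS => n /=.
  by rewrite in_itv/= -ler_norml.
have {lim_ex}[lim limP] := choice lim_ex; exists lim => N.
(* The pair holds the step number and a lower bound for the index to be chosen. *)
have step (kN : nat * nat) : exists n, (kN.2 <= n)%N /\
    forall A, A \in E kN.1 -> `|lim A - x n A| < kN.1.+1%:R^-1.
  case: kN => k M /=.
  have UE : U (\bigcap_(A in [set` E k]) [set n | `|lim A - x n A| < k.+1%:R^-1]).
    apply: filter_bigI => A _; have /cvgrPdist_lt := limP A; apply.
    by rewrite invr_gt0.
  have UM : U [set n | (M <= n)%N] by apply: ooU; exact: nbhs_infty_ge.
  have [n [nE nM]] := filter_ex (filterI UE UM).
  by exists n; split => // A AE; exact: (nE A).
have {step}[psi psiP] := choice step.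
(* The lower bound [(phi k').+1] forces strict growth. *)
pose phi := fix phi k := if k is k'.+1 then psi (k, (phi k').+1) else psi (0, N)%N.
have phiS k : (phi k < phi k.+1)%N by case: (psiP (k.+1, (phi k).+1)).
exists phi; split => // [k|A AE].
  elim: k => [|k IH]; first by case: (psiP (0, N)%N).
  exact: leq_trans IH (ltnW (phiS k)).
apply/cvgrPdist_lt => e e0; near=> k.
have AEk : A \in E k by near: k.
apply: (@lt_trans _ _ k.+1%:R^-1); last first.
  by near: k; exact: (near_infty_natSinv_lt (PosNum e0)).
by move: AEk; case: (k) => [|k'] AEk'; [case: (psiP (0, N)%N)|
  case: (psiP (k'.+1, (phi k').+1))] => _ /(_ A AEk').
Unshelve. all: by end_near. Qed.

(** * Boxes of the lattice *)

Section Lattice.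
Context {d : nat}.
Implicit Types (i : site d) (L A : {fset site d}).

Lemma in_D n i : (i \in D d n) = (Defs.norm1 i < n)%N.
Proof.
rewrite !inE /=; apply: andb_idl => i_n.
have n0 : (0 < 2 * n)%N by rewrite muln_gt0 (leq_trans _ i_n).
(* The shifted coordinates lie between 0 and [2 * n - 2], so the default value of [insubd] is never
   taken. *)
pose f : {ffun 'I_d -> 'I_(2 * n)} :=
  [ffun k => insubd (Ordinal n0) (absz (i ord0 k + n.-1%:Z))].
apply/mapP; exists f; rewrite ?mem_enum//; apply/rowP => k; rewrite !mxE ffunE.
have ik : (`|i ord0 k| < n)%N.
  by rewrite (leq_ltn_trans _ i_n)// /Defs.norm1 (bigD1 k)//= leq_addr.
have /andP[ik1 ik2] : - (n.-1%:Z) <= i ord0 k <= n.-1%:Z.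
  by rewrite -ler_norml -abszE lez_nat -ltnS prednK// (leq_ltn_trans _ ik).
have ik0 : 0 <= i ord0 k + n.-1%:Z by rewrite -lerBlDr sub0r.
rewrite val_insubd ifT ?gez0_abs ?addrK// -ltz_nat gez0_abs//.
rewrite (le_lt_trans (lerD ik2 (lexx _)))// -PoszD ltz_nat.
by rewrite addnn mul2n ltn_double prednK// (leq_ltn_trans _ ik).
Qed.

Lemma subset_D n n' : (n <= n')%N -> (D d n `<=` D d n')%fset.
Proof. by move=> nn'; apply/fsubsetP => i; rewrite !in_D => /leq_trans; apply. Qed.

Lemma norm1D (i j : site d) : (Defs.norm1 (i + j)%R <= Defs.norm1 i + Defs.norm1 j)%N.
Proof.
rewrite /Defs.norm1 -big_split/=; apply: leq_sum => k _; rewrite mxE.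
by rewrite -lez_nat PoszD !abszE; exact: ler_normD.
Qed.

Lemma star_subset_D n i : i \in D d n.-1 -> (i |` nbr i `<=` D d n)%fset.
Proof.
rewrite in_D => i_n; apply/fsubsetP => j /fset1UP[->|].
  by rewrite in_D (leq_trans i_n)// leq_pred.
move=> /imfsetP[v /= vU ->].
have v1 : Defs.norm1 v = 1%N by move: vU; rewrite !inE/= => /andP[_ /eqP].
rewrite in_D (leq_ltn_trans (norm1D _ _))// v1 addn1.
by case: n i_n.
Qed.

Lemma near_subset_D L : \forall n \near \oo, (L `<=` D d n)%fset.
Proof.
exists (\max_(i <- L) Defs.norm1 i).+1 => // n /= Ln; apply/fsubsetP => i iL.
by rewrite in_D (leq_trans _ Ln)// ltnS; exact: leq_bigmax_seq.
Qed.

End Lattice.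

(** * The linear programs *)

Section LinearProgram.
Context {R : realType} {d : nat}.
Variables (J h : R) (c : site d -> S d -> R).
Hypothesis rate_c : is_rate J h c.
Implicit Types (L A : {fset site d}) (mv a : {fset site d} -> R).

Definition flip_term L a (i : site d) (s : S d) : R :=
  c i s * (poly_eval L a (flip i s) - poly_eval L a s).

(** The rate at [i] reads one step beyond [i], hence stays in [D d n] when [i] is in [D d n.-1]; the
    polynomial reads only [L]. *)
Lemma local_flip_term L a n i : (L `<=` D d n.-1)%fset -> i \in L ->
  local (D d n) (flip_term L a i).
Proof.
move=> LD iL s s' ss'.
have LDn : (L `<=` D d n)%fset := fsubset_trans LD (subset_D (leq_pred n)).
have sL j : j \in L -> s j = s' j by move=> jL; exact/ss'/(fsubsetP LDn).
case: rate_c => _ local_c _; rewrite /flip_term (local_c i s s') => [|j jn].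
  rewrite (local_poly a sL) (local_poly a (s' := flip i s'))// => j jL.
  by rewrite /flip sL.
by apply: ss'; apply: fsubsetP jn; apply/star_subset_D/(fsubsetP LD).
Qed.

Lemma flip_term_notin L a i : i \notin L -> flip_term L a i = fun=> 0.
Proof.
move=> iL; apply/funext => s; rewrite /flip_term.
rewrite (local_poly a (s' := s)) ?subrr ?mulr0// => j jL.
by rewrite /flip; case: eqP => // ji; rewrite -ji jL in iL.
Qed.

Lemma poly_eval_widen L L' a : (L `<=` L')%fset ->
  poly_eval L' (fun A => if (A `<=` L)%fset then a A else 0) = poly_eval L a.
Proof.
move=> LL'; apply/funext => s; rewrite /poly_eval.
rewrite -[RHS](@eq_big_seq _ _ _ _ _
    (fun A => (if (A `<=` L)%fset then a A else 0) * sA R A s)); last first.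
  by move=> A; rewrite fpowersetE => ->.
apply/esym/big_fset_incl; first by rewrite fpowersetS.
by move=> A _; rewrite fpowersetE => /negbTE->; rewrite mul0r.
Qed.

(** Extending the coefficients by zero gives a test polynomial on [D d n.-1], and its flip terms
    outside [L] vanish. *)
Lemma feasible_inv n mv L a : LP_feasible c n mv -> (L `<=` D d n.-1)%fset ->
  \sum_(i <- L) lin_apply mv (D d n) (flip_term L a i) = 0.
Proof.
move=> [_ _ _ inv] LD.
have /= := inv (fun A => if (A `<=` L)%fset then a A else 0).
rewrite (poly_eval_widen _ LD) => invL; rewrite -[RHS]invL.
apply: big_fset_incl => // i _ iL.
by rewrite -/(flip_term L a i) flip_term_notin// lin_apply0.
Qed.

Lemma feasible_pos n mv L u : LP_feasible c n mv -> (L `<=` D d n)%fset ->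
  0 <= lin_apply mv L (Fcyl R L u).
Proof.
move=> [pos _ _ _] LD; rewrite -(lin_apply_widen mv LD (@local_Fcyl R d L u)).
apply: lin_apply_ge0 => // [|s]; first exact: local_widen LD (@local_Fcyl R d L u).
by rewrite Fcyl_indic.
Qed.

Lemma feasible_one n mv : LP_feasible c n mv -> mv fset0 = 1.
Proof. by case=> _ one _ _; rewrite -[RHS]one lin_apply_cst mul1r. Qed.

Lemma feasible_bound n mv A : LP_feasible c n mv -> (A `<=` D d n)%fset ->
  `|mv A| <= 1.
Proof. by move=> [pos one _ _] AD; exact: moment_bound AD pos one. Qed.

(** The flip terms at sites of [D d n.-1] are local to [D d n], so evaluating them on the larger box
    gives the same values. This makes the optimal values monotone. *)
Lemma feasible_restrict n mv : LP_feasible c n.+1 mv -> LP_feasible c n mv.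
Proof.
move=> fmv; have Dn : (D d n `<=` D d n.+1)%fset := subset_D (leqnSn n).
split=> [u||A B AD BD|a].
- exact: feasible_pos fmv Dn.
- by rewrite lin_apply_cst mul1r (feasible_one fmv).
- by case: fmv => _ _ sym _; apply: sym; exact: fsubset_trans Dn.
rewrite -[RHS](feasible_inv a fmv (subset_D (leq_pred n))).
apply: eq_big_seq => i iD; rewrite -/(flip_term _ a i) (lin_apply_widen _ Dn)//.
exact: local_flip_term iD.
Qed.

Lemma moments_feasible n (mu : probability (SM d) R) :
  lattice_symmetric mu -> ising_invariant c mu -> LP_feasible c n (moments mu).
Proof.
move=> sym inv; split=> [u||A B _ _ [g [Gg ->]]|a].
- rewrite -lee_fin -(lin_apply_moments mu (@local_Fcyl R d _ u)).
  by apply: integral_ge0 => s _; rewrite Fcyl_indic lee_fin.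
- apply: EFin_inj; rewrite -(lin_apply_moments mu (@local_cst R d _ 1)).
  by rewrite integral_cst//= (@probability_setT _ _ _ mu) mule1.
- by rewrite /moments (sym A g Gg).
apply: EFin_inj; rewrite -sumEFin -[RHS](inv (D d n.-1) a).
apply: eq_big_seq => i iD.
by rewrite -(lin_apply_moments mu (local_flip_term a _ iD)).
Qed.

Lemma cvg_lin_apply (x : nat -> {fset site d} -> R) (lim : {fset site d} -> R) L g :
  (forall A, x k A @[k --> \oo] --> lim A) ->
  lin_apply (x k) L g @[k --> \oo] --> lin_apply lim L g.
Proof.
by move=> xl; apply: cvg_big => [|A _]; [exact: add_continuous|exact: cvgMl_tmp].
Qed.

End LinearProgram.

(** * Convergence of the optimal values and the optimal invariant measure *)

Theorem mainTheorem6 (R : realType) (d : nat) (J h : R) (c : site d -> S d -> R)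
  (m : nat) (pc : {fset site d} -> R) (mstar : nat -> {fset site d} -> R) :
  is_rate J h c -> covariant c ->
  (forall n : nat, (m <= n)%N ->
     LP_feasible c n (mstar n) /\
     (forall mv : {fset site d} -> R, LP_feasible c n mv ->
        lin_apply (mstar n) (D d n) (poly_eval (D d m) pc)
        <= lin_apply mv (D d n) (poly_eval (D d m) pc))) ->
  exists pinf : R,
    (fun n : nat => lin_apply (mstar n) (D d n) (poly_eval (D d m) pc)) @ \oo --> pinf /\
    forall l : nat, exists (phi : nat -> nat) (lim : {fset site d} -> R),
      [/\ forall k, (maxn m l <= phi k)%N,
          forall k, (phi k < phi k.+1)%N,
          forall A : {fset site d}, (A `<=` D d l)%fset ->
            (fun k : nat => mstar (phi k) A) @ \oo --> lim A
        & exists mu : probability (SM d) R,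
          [/\ lattice_symmetric mu,
              ising_invariant c mu,
              (\int[mu]_s (poly_eval (D d m) pc s)%:E = pinf%:E)%E,
              forall A : {fset site d}, (A `<=` D d l)%fset ->
                (\int[mu]_s (sA R A s)%:E = (lim A)%:E)%E
            & forall mu' : probability (SM d) R,
                lattice_symmetric mu' -> ising_invariant c mu' ->
                (\int[mu]_s (poly_eval (D d m) pc s)%:E
                 <= \int[mu']_s (poly_eval (D d m) pc s)%:E)%E]].
Proof.
move=> rate_c _ opt; set p := poly_eval (D d m) pc.
set u := fun n : nat => lin_apply (mstar n) (D d n) p.
have feas n : (m <= n)%N -> LP_feasible c n (mstar n) by move=> /opt[].
have local_p : local (D d m) p by exact: local_poly.
have uE n : (m <= n)%N -> u n = lin_apply (mstar n) (D d m) p.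
  by move=> mn; apply: lin_apply_widen local_p; exact: subset_D.
(* The minimizer at [n.+1] is a competitor in the program at [n]. *)
have u_nd n : (m <= n)%N -> u n <= u n.+1.
  move=> mn; have [_ /(_ (mstar n.+1))] := opt _ mn.
  rewrite (uE _ (leqW mn)) (lin_apply_widen (mstar n.+1) (subset_D mn) local_p).
  apply; apply: (feasible_restrict rate_c); exact/feas/leqW.
have u_bound n : (m <= n)%N -> u n <= \sum_(A <- fpowerset (D d m)) `|pc A|.
  move=> mn; rewrite uE// lin_apply_poly big_seq [leRHS]big_seq; apply: ler_sum => A.
  rewrite fpowersetE => AD; rewrite (le_trans (ler_norm _))// normrM ler_piMr//.
  exact: feasible_bound (feas n mn) (fsubset_trans AD (subset_D mn)).
have [pinf u_pinf] : exists pinf : R, u @ \oo --> pinf.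
  (* The shift discards the indices below [m], where nothing is known about [mstar]. *)
  have : cvgn (fun n => u (n + m)%N).
    apply: nondecreasing_is_cvgn.
      by apply/nondecreasing_seqP => n; rewrite addSn; apply: u_nd; exact: leq_addl.
    by eexists => _ [n _ <-]; apply: u_bound; exact: leq_addl.
  by move=> /cvg_ex[pinf]; rewrite cvg_shiftn => up; exists pinf.
exists pinf; split => // l.
have near_feas : \forall n \near \oo, LP_feasible c n (mstar n).
  by exists m => // n /feas.
have mstar_bound A : \forall n \near \oo, `|mstar n A| <= 1.
  have := near_subset_D A; apply: filterS2 near_feas => n fn AD.
  exact: feasible_bound fn AD.
(* The boxes exhaust the lattice, so every finite [A] eventually belongs to [fpowerset (D d k)] and
   all moments converge, not only those inside [D d l]. *)
have [lim limP] := pointwise_subsequence (fun k => fpowerset (D d k)) mstar_bound.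
have [phi [phi_ge phi_incr phi_lim]] := limP (maxn m l).
have {limP phi_lim} mstar_lim A : mstar (phi k) A @[k --> \oo] --> lim A.
  by apply: phi_lim; apply: filterS (near_subset_D A) => k; rewrite fpowersetE.
have phi_id k : (k <= phi k)%N.
  by elim: k => // k IH; exact: leq_ltn_trans IH (phi_incr k).
have phi_oo : phi k @[k --> \oo] --> \oo.
  by apply/cvgnyPge => N; exists N => // k /= /leq_trans; apply.
(* The box [D d (phi k).-1] is the one carrying the test polynomials of the invariance
   constraint. *)
have near_phi L : \forall k \near \oo,
    LP_feasible c (phi k) (mstar (phi k)) /\ (L `<=` D d (phi k).-1)%fset.
  have [N _ LD] := near_subset_D L; exists N.+1 => // k /= Nk; split.
    by apply: feas; exact: leq_trans (leq_maxl _ _) (phi_ge k).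
  have Nphi := leq_trans Nk (phi_id k).
  by apply: LD => /=; rewrite -ltnS (ltn_predK Nphi).
have near_phiW L : \forall k \near \oo,
    LP_feasible c (phi k) (mstar (phi k)) /\ (L `<=` D d (phi k))%fset.
  apply: filterS (near_phi L) => k [fk LD]; split => //.
  exact: fsubset_trans LD (subset_D (leq_pred _)).
have lim_unique L g r :
    (\forall k \near \oo, lin_apply (mstar (phi k)) L g = r) -> lin_apply lim L g = r.
  move=> near_r; have xl := cvg_lin_apply (L := L) (g := g) mstar_lim.
  have xr : lin_apply (mstar (phi k)) L g @[k --> \oo] --> r by exact: cvg_near_cst.
  exact: (norm_cvg_unique xl xr).
exists phi, lim; split => //.
have lim_pos L s : 0 <= lin_apply lim L (Fcyl R L s).
  apply: cvgr_to_ge (cvg_lin_apply (L := L) (g := Fcyl R L s) mstar_lim) _.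
  by apply: filterS (near_phiW L) => k [fk LD]; exact: feasible_pos fk LD.
have lim_one : lim fset0 = 1.
  rewrite -(lin_apply_sA lim (fsubset_refl fset0)); apply: lim_unique.
  apply: filterS (near_phi fset0) => k [fk _].
  by rewrite lin_apply_sA// (feasible_one fk).
have [mu muE] := moment_problem lim_pos lim_one.
have mu_sA A : (\int[mu]_s (sA R A s)%:E = (lim A)%:E)%E.
  by rewrite (muE A)//; [rewrite lin_apply_sA|exact: local_sA].
have mu_p : (\int[mu]_s (p s)%:E = pinf%:E)%E.
  rewrite (muE _ _ local_p); congr EFin.
  apply: norm_cvg_unique (cvg_lin_apply (L := D d m) (g := p) mstar_lim) _.
  (* The full sequence of optimal values tends to [pinf], hence so does its subsequence along
     [phi]. *)
  apply: cvg_trans (cvg_comp _ _ phi_oo u_pinf); apply: near_eq_cvg.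
  by near=> k; rewrite /= uE// (leq_trans (leq_maxl _ _) (phi_ge k)).
exists mu; split => //.
- move=> A g Gg; rewrite !mu_sA; congr EFin.
  apply: norm_cvg_unique (mstar_lim A) _.
  apply: cvg_trans (mstar_lim _); apply: near_eq_cvg.
  apply: filterS2 (near_phiW A) (near_phiW [fset g x | x in A]%fset).
  move=> k [[_ _ sym _] AD] [_ gAD].
  by apply/esym/sym => //; exists g.
(* All flip terms of [L] are local to the fixed box [D d n0.+1], so the limit in [k] is taken on a
   box independent of [k]. *)
- move=> L a; have [n0 _ LD] := near_subset_D L.
  have LDn0 : (L `<=` D d n0.+1.-1)%fset := LD n0 (leqnn n0).
  transitivity (\sum_(i <- L) (lin_apply lim (D d n0.+1) (flip_term c L a i))%:E)%E.
    apply: eq_big_seq => i iL.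
    by rewrite -(muE _ _ (local_flip_term rate_c a LDn0 iL)).
  rewrite sumEFin -lin_apply_sum; congr EFin; apply: lim_unique.
  apply: filterS2 (near_phi L) (near_phiW (D d n0.+1)) => k [fk LD'] [_ Dk].
  rewrite lin_apply_sum -[RHS](feasible_inv a fk LD').
  apply: eq_big_seq => i iL; apply/esym/lin_apply_widen => //.
  exact: (local_flip_term rate_c a LDn0 iL).
(* The moments of [mu'] compete in every program, so its integral bounds each [u n] with [m <= n]
   from above, and thus the limit. *)
- move=> mu' sym' inv'; rewrite mu_p (lin_apply_moments mu' local_p) lee_fin.
  apply: cvgr_to_le u_pinf _; exists m => // n /= mn.
  have [_ /(_ _ (moments_feasible rate_c n sym' inv'))] := opt n mn.
  by rewrite [X in _ <= X](lin_apply_widen _ (subset_D mn) local_p).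
Unshelve. all: by end_near. Qed.
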